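(* For subsets of finitely generated free groups, the following inclusions of classes hold and are both strict: $$\mathbf{VPL}^\forall\subsetneq \mathbf{VPL}^{red}\subsetneq \mathbf{VPL}^\exists .$$ That is: for every finite set $X$ and every $S\subseteq F(X)$, if $S$ is $\mathbf{VPL}^\forall$ then $S$ is $\mathbf{VPL}^{red}$, and if $S$ is $\mathbf{VPL}^{red}$ then $S$ is $\mathbf{VPL}^\exists$; moreover there exist a finite set $X$ and a set $S\subseteq F(X)$ that is $\mathbf{VPL}^{red}$ but not $\mathbf{VPL}^\forall$, and there exist a finite set $X$ and a set $S\subseteq F(X)$ that is $\mathbf{VPL}^\exists$ but not $\mathbf{VPL}^{red}$.
   Context: Notation: for a finite set $X$, $F(X)$ is the free group on $X$, $\Sigma = X\cup X^{-1}$ is the alphabet containing for each $x\in X$ two distinct formal symbols $x,x^{-1}$, and $\pi:\Sigma^\star\to F(X)$ is the monoid homomorphism sending each letter to the corresponding group element. A word over $\Sigma$ is reduced if it contains no factor $aa^{-1}$ with $a\in\Sigma$ (where $(x^{-1})^{-1}=x$). Visibly pushdown automaton (VPA): a pushdown automaton (finite set of states, initial state(s), set of accepting states, stack alphabet $\Gamma$ with a distinguished bottom-of-stack symbol $\bot\in\Gamma$, initial stack $\bot$) over $\Sigma$ without $\varepsilon$-transitions, for which there is a partition $\Sigma=\Sigma_c\sqcup\Sigma_i\sqcup\Sigma_r$ (calls, internals, responses; parts may be empty) such that: on reading a letter of $\Sigma_i$ the transition neither depends on nor modifies the stack; on reading a letter of $\Sigma_c$ the transition does not depend on the stack and pushes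 exactly one symbol, different from $\bot$; on reading a letter of $\Sigma_r$ the transition reads the topmost stack symbol and pops it, pushing nothing (if the topmost symbol is $\bot$, it is read but not removed). A word is accepted if the automaton can be in an accepting state after reading it, with no condition on the stack. (Deterministic and nondeterministic VPAs accept the same languages.) A language over $\Sigma$ is in $\mathbf{VPL}$ if it is accepted by a VPA for some partition of $\Sigma$. A set $S\subseteq F(X)$ is: $\mathbf{VPL}^\forall$ if $\pi^{-1}(S)\in\mathbf{VPL}$; $\mathbf{VPL}^\exists$ if there is $L\subseteq\Sigma^\star$ in $\mathbf{VPL}$ with $\pi(L)=S$; $\mathbf{VPL}^{red}$ if the set of all reduced words $w\in\Sigma^\star$ with $\pi(w)\in S$ is in $\mathbf{VPL}$ (equivalently, $S$ is represented by a language of reduced words accepted by some VPA). *)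

(* Defs.v *)
From HB Require Import structures.
From mathcomp Require Import all_boot.
From mathcomp Require Import boolp classical_sets.

Set Implicit Arguments.
Unset Strict Implicit.
Unset Printing Implicit Defensive.

Local Open Scope group_scope.
Local Open Scope classical_set_scope.

(* [(x, false)] is the symbol x and [(x, true)] the symbol x^-1. *)
Definition letter (X : finType) : Type := (X * bool)%type.

Definition inv_letter (X : finType) (a : letter X) : letter X := (a.1, ~~ a.2).

Definition reduced (X : finType) (w : seq (letter X)) : bool :=
  [forall a : letter X, ~~ infix [:: a; inv_letter a] w].

(* The free group on X, realised as the reduced words under concatenation
   followed by free reduction; [freegroup_universal] below is its universal
   property. *)
Record freegroup (X : finType) : Type := FreeGroup {
  fgword :> seq (letter X);
  fgword_reduced : reduced fgword
}.
HB.instance Definition _ (X : finType) := [isSub for @fgword X].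
HB.instance Definition _ (X : finType) := [Choice of freegroup X by <:].

Section FreeGroup.
Variable X : finType.
Implicit Types (a b : letter X) (u v w : seq (letter X)) (x y z : freegroup X).

Lemma inv_letterK : involutive (@inv_letter X).
Proof. by case=> x b; rewrite /inv_letter /= negbK. Qed.

Lemma reduced_nil : reduced ([::] : seq (letter X)).
Proof. by apply/forallP. Qed.

Lemma reduced_cons a w :
  reduced (a :: w) =
    (if w is b :: _ then b != inv_letter a else true) && reduced w.
Proof.
apply/forallP/andP => [H | [Hw /forallP H] c].
  split; last first.
    by apply/forallP => c; apply: contra (H c); rewrite infix_consl orbC => ->.
  case: w H => // b w /(_ a); apply: contra => /eqP->.
  by rewrite infix_consl /= !eqxx prefix0s.
rewrite infix_consl negb_or H andbT.
by case: w Hw {H} => [|b w] Hw /=; rewrite ?andbF //; case: eqP => //= ->;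
   rewrite eq_sym (negbTE Hw).
Qed.

Definition cons_reduce a w : seq (letter X) :=
  if w is b :: w' then (if b == inv_letter a then w' else a :: w) else [:: a].

(* For reduced [v], the free reduction of [u ++ v]. *)
Definition cat_reduce u v : seq (letter X) := foldr cons_reduce v u.

Lemma cons_reduce_reduced a w : reduced w -> reduced (cons_reduce a w).
Proof.
case: w => [|b w] Hw; first by rewrite /= reduced_cons.
rewrite /cons_reduce; case: ifP => [_ | ba].
  by move: Hw; rewrite reduced_cons => /andP[].
by rewrite reduced_cons ba Hw.
Qed.

Lemma cat_reduce_reduced u v : reduced v -> reduced (cat_reduce u v).
Proof. by move=> rv; elim: u => //= a u; apply: cons_reduce_reduced. Qed.

Lemma cons_reduceK a w :
  reduced w -> cons_reduce a (cons_reduce (inv_letter a) w) = w.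
Proof.
case: w => [|b w] rw; first by rewrite /= eqxx.
rewrite {2}/cons_reduce inv_letterK; case: eqP => [ba | _]; last first.
  by rewrite /= eqxx.
subst b; move: rw; rewrite reduced_cons => /andP[+ _].
by case: w => //= c w /negbTE->.
Qed.

Lemma cat_reduce_cons a u v : reduced v ->
  cat_reduce (cons_reduce a u) v = cons_reduce a (cat_reduce u v).
Proof.
move=> rv; case: u => //= b u; case: eqP => //= ->.
by rewrite cons_reduceK // cat_reduce_reduced.
Qed.

Lemma cat_reduceA u v w : reduced w ->
  cat_reduce (cat_reduce u v) w = cat_reduce u (cat_reduce v w).
Proof. by move=> rw; elim: u => //= a u IH; rewrite cat_reduce_cons // IH. Qed.

Lemma cons_reduce_id a w : reduced (a :: w) -> cons_reduce a w = a :: w.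
Proof.
by rewrite reduced_cons; case: w => //= b w /andP[/negbTE-> _].
Qed.

Lemma cat_reduce0 u : reduced u -> cat_reduce u [::] = u.
Proof.
elim: u => //= a u IH rau; have := rau; rewrite reduced_cons => /andP[_ ru].
by rewrite IH // cons_reduce_id.
Qed.

Definition inv_word u : seq (letter X) := rev (map (@inv_letter X) u).

Lemma inv_wordK : involutive inv_word.
Proof.
move=> u; rewrite /inv_word map_rev revK -map_comp map_id_in // => a _ /=.
exact: inv_letterK.
Qed.

Lemma inv_word_reduced u : reduced u -> reduced (inv_word u).
Proof.
move=> /forallP ru; apply/forallP => a; apply: contra (ru a).
move=> /infixP[p [s uE]]; apply/infixP; exists (inv_word s), (inv_word p).
rewrite -[LHS]inv_wordK uE /inv_word !map_cat !rev_cat /= -catA.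
by rewrite /rev /= inv_letterK.
Qed.

Lemma cat_reduceV u w : reduced w ->
  cat_reduce (inv_word u) (cat_reduce u w) = w.
Proof.
move=> rw; elim: u => //= a u IH.
rewrite /inv_word /= rev_cons /cat_reduce foldr_rcons.
have := @cons_reduceK (inv_letter a) _ (cat_reduce_reduced u rw).
by rewrite inv_letterK => ->.
Qed.

Definition fg_one : freegroup X := FreeGroup reduced_nil.
Definition fg_mul x y : freegroup X :=
  FreeGroup (cat_reduce_reduced x (fgword_reduced y)).
Definition fg_inv x : freegroup X :=
  FreeGroup (inv_word_reduced (fgword_reduced x)).

Lemma fg_mulA : associative fg_mul.
Proof.
by move=> x y z; apply: val_inj; rewrite /= cat_reduceA // fgword_reduced.
Qed.

Lemma fg_mul1 : left_id fg_one fg_mul.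
Proof. by move=> x; apply: val_inj. Qed.

Lemma fg_mulx1 : right_id fg_one fg_mul.
Proof. by move=> x; apply: val_inj; rewrite /= cat_reduce0 // fgword_reduced. Qed.

Lemma fg_mulV : left_inverse fg_one fg_inv fg_mul.
Proof.
move=> x; apply: val_inj => /=.
by have := cat_reduceV x reduced_nil; rewrite cat_reduce0 // fgword_reduced.
Qed.

Lemma fg_mulxV : right_inverse fg_one fg_inv fg_mul.
Proof.
move=> x; rewrite -{1}[x](_ : fg_inv (fg_inv x) = x) ?fg_mulV //.
by apply: val_inj; rewrite /= inv_wordK.
Qed.

HB.instance Definition _ := isGroup.Build (freegroup X)
  fg_mulA fg_mul1 fg_mulx1 fg_mulV fg_mulxV.

Lemma reduced1 a : reduced [:: a].
Proof. by rewrite reduced_cons reduced_nil. Qed.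

Definition fg_gen (x : X) : freegroup X := FreeGroup (reduced1 (x, false)).

Definition letter_val a : freegroup X :=
  if a.2 then (fg_gen a.1)^-1 else fg_gen a.1.

Definition word_pi (w : seq (letter X)) : freegroup X :=
  \prod_(a <- w) letter_val a.

Lemma letter_valE a : letter_val a = FreeGroup (reduced1 a).
Proof. by case: a => x [] /=; apply: val_inj. Qed.

Lemma fgword_word_pi w : word_pi w = foldr cons_reduce [::] w :> seq _.
Proof.
rewrite /word_pi; elim: w => [|a w IH]; first by rewrite big_nil.
by rewrite big_cons letter_valE /= IH.
Qed.

Lemma word_pi_id x : word_pi x = x.
Proof.
apply: val_inj; rewrite /= fgword_word_pi.
exact: cat_reduce0 (fgword_reduced x).
Qed.

End FreeGroup.

Lemma freegroup_universal (X : finType) (G : groupType) (f : X -> G) :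
  exists h : freegroup X -> G,
    [/\ {morph h : x y / x * y}, forall x, h (fg_gen x) = f x &
        forall h' : freegroup X -> G, {morph h' : x y / x * y} ->
          (forall x, h' (fg_gen x) = f x) -> h' =1 h].
Proof.
pose lv (a : letter X) := if a.2 then (f a.1)^-1 else f a.1.
pose h (u : seq (letter X)) := \prod_(a <- u) lv a.
have lvV a : lv (inv_letter a) = (lv a)^-1.
  by case: a => x []; rewrite /lv /= ?invgK.
have hcons a u : h (cons_reduce a u) = lv a * h u.
  case: u => [|b u] /=; first by rewrite /h big_seq1 big_nil mulg1.
  by case: eqP => [-> | _]; rewrite /h !big_cons // lvV mulVKg.
exists (fun x => h x); split=> [x y | x | h' h'M h'f x].
- rewrite /= /h; elim: (fgword x) => [|a u IH] /=.
    by rewrite big_nil mul1g.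
  by rewrite -/(h _) hcons /h IH big_cons mulgA.
- by rewrite /h /= big_seq1.
have h'1 : h' 1 = 1 by apply: (mulgI (h' 1)); rewrite -h'M !mulg1.
have h'V y : h' y^-1 = (h' y)^-1.
  by apply: (mulgI (h' y)); rewrite -h'M !mulgV h'1.
rewrite -{1}(word_pi_id x) /word_pi /h.
elim: (fgword x) => [|a u IH]; first by rewrite !big_nil.
rewrite !big_cons h'M IH; congr (_ * _).
by case: a => y []; rewrite /letter_val /lv /= ?h'V h'f.
Qed.

Variant letter_kind := Call | Internal | Response.

(* The partition of the alphabet is given by the map [vpa_kind]; each
   transition relation is consulted only on letters of its own kind. *)
Record vpa (Sigma : finType) : Type := VPA {
  vpa_state : finType;
  vpa_stack : finType;
  vpa_bot : vpa_stack;
  vpa_initial : pred vpa_state;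
  vpa_final : pred vpa_state;
  vpa_kind : Sigma -> letter_kind;
  vpa_call : vpa_state -> Sigma -> vpa_state -> vpa_stack -> bool;
  vpa_internal : vpa_state -> Sigma -> vpa_state -> bool;
  vpa_response : vpa_state -> Sigma -> vpa_stack -> vpa_state -> bool;
  vpa_call_not_bot : forall p a q g, vpa_call p a q g -> g != vpa_bot
}.

Section VPARun.
Variables (Sigma : finType) (A : vpa Sigma).

(* The head of the stack is its topmost symbol. *)
Definition vpa_config : Type := (vpa_state A * seq (vpa_stack A))%type.

Inductive vpa_step (a : Sigma) : vpa_config -> vpa_config -> Prop :=
| StepCall p q g s :
    vpa_kind A a = Call -> vpa_call p a q g ->
    vpa_step a (p, s) (q, g :: s)
| StepInternal p q s :
    vpa_kind A a = Internal -> vpa_internal p a q ->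
    vpa_step a (p, s) (q, s)
| StepPop p q g s :
    vpa_kind A a = Response -> g != vpa_bot A -> vpa_response p a g q ->
    vpa_step a (p, g :: s) (q, s)
| StepBottom p q s :
    vpa_kind A a = Response -> vpa_response p a (vpa_bot A) q ->
    vpa_step a (p, vpa_bot A :: s) (q, vpa_bot A :: s).

Fixpoint vpa_run (w : seq Sigma) (c d : vpa_config) : Prop :=
  if w is a :: w' then exists2 e, vpa_step a c e & vpa_run w' e d else c = d.

Definition vpa_lang : set (seq Sigma) :=
  [set w | exists p q s, [/\ vpa_initial p, vpa_final q &
                             vpa_run w (p, [:: vpa_bot A]) (q, s)]].

End VPARun.

Definition VPL (Sigma : finType) (L : set (seq Sigma)) : Prop :=
  exists A : vpa Sigma, L = vpa_lang A.

Definition VPL_forall (X : finType) (S : set (freegroup X)) : Prop :=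
  VPL (@word_pi X @^-1` S).

Definition VPL_exists (X : finType) (S : set (freegroup X)) : Prop :=
  exists2 L : set (seq (letter X)), VPL L & @word_pi X @` L = S.

Definition VPL_red (X : finType) (S : set (freegroup X)) : Prop :=
  VPL [set w : seq (letter X) | reduced w /\ S (word_pi w)].

(* Main.v *)
(** Both separations rest on the rigidity of the partition of the alphabet.  If
    no [u n] contains a call, the stack is still [bot] after reading [u n]; if
    each [v n] contains only calls, the stack is never inspected while reading
    [v n].  In both cases a word [u n ++ v k] is accepted according to the set of
    states reachable on [u n], and two of these sets coincide.  For [{1}] in the
    free group of rank one this excludes the words [a^n a^-n], whatever the
    kinds of [a] and [a^-1].  For [{a^n b a^m | m < n}], it excludes the reduced
    words, since [a] has one kind on both sides of [b]; but the set is the image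
    of the words [a^n b (a b b^-1)^m], [m < n], in which [a] is a call, [b] and
    [b^-1] are responses, and each factor [a b b^-1] pops one net symbol. *)
Require Import Defs.
From mathcomp Require Import all_boot.
From mathcomp Require Import boolp classical_sets.

Set Implicit Arguments.
Unset Strict Implicit.
Unset Printing Implicit Defensive.

Local Open Scope group_scope.
Local Open Scope classical_set_scope.

(** * Runs that ignore the stack, and collisions of state sets *)

Definition is_call (k : letter_kind) : bool := if k is Call then true else false.

Section Runs.
Variables (Sigma : finType) (A : vpa Sigma).
Implicit Types (u v w : seq Sigma) (c d : vpa_config A).

Lemma vpa_run_cat u v c d :
  vpa_run (u ++ v) c d <-> exists2 e, vpa_run u c e & vpa_run v e d.
Proof.
elim: u c => [|a u IH] c /=; first by split=> [?|[e ->]] //; exists c.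
split=> [[e ce /IH[f ef fd]]|[f [e ce ef] fd]]; first by exists f => //; exists e.
by exists e => //; apply/IH; exists f.
Qed.

(** A call pushes without reading the stack, so the same transitions can be replayed above any
    [s']. *)
Lemma vpa_run_calls v p q s t s' :
  all (fun a => is_call (vpa_kind A a)) v -> vpa_run (A := A) v (p, s) (q, t) ->
  exists t', vpa_run (A := A) v (p, s') (q, t').
Proof.
elim: v p s s' => [|a v IH] p s s' /= => [_ [-> _]|/andP[ka cv]].
  by exists s'.
case=> e pe; inversion pe as [p1 q1 g s1 k1 tr|? ? ? k1|? ? ? ? k1|? ? ? k1];
  subst; rewrite k1 // in ka.
move=> /(IH _ _ (g :: s') cv)[t' rt]; exists t', (q1, g :: s') => //.
exact: StepCall.
Qed.

(** Internal letters leave the stack alone, and a response at the bottom symbol reads it without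
    removing it. *)
Lemma vpa_run_not_calls u p q s :
  all (fun a => ~~ is_call (vpa_kind A a)) u ->
  vpa_run (A := A) u (p, [:: vpa_bot A]) (q, s) -> s = [:: vpa_bot A].
Proof.
elim: u p => [|a u IH] p /= => [_ [_ ->]//|/andP[ka cu]].
case=> e pe; inversion pe as [? ? ? ? k1|? ? ? k1|? ? ? ? k1 gb|? ? ? k1];
  subst; rewrite ?k1 // in ka; try exact: IH.
by rewrite eqxx in gb.
Qed.

End Runs.

Lemma finite_range_collision (T : finType) (f : nat -> T) :
  exists n m, n < m /\ f n = f m.
Proof.
pose g (i : 'I_#|T|.+1) := f i.
case: (boolP (injectiveb g)) => [/injectiveP/leq_card|].
  by rewrite card_ord ltnn.
move=> /injectivePn[i [j ij gij]].
case: (ltngtP i j) => [lt|lt|/val_inj eij]; last by rewrite eij eqxx in ij.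
  by exists i, j.
by exists j, i.
Qed.

Lemma vpa_collision (Sigma : finType) (A : vpa Sigma) (u v : nat -> seq Sigma) :
  (forall n, all (fun a => ~~ is_call (vpa_kind A a)) (u n)) \/
  (forall n, all (fun a => is_call (vpa_kind A a)) (v n)) ->
  exists n m, n < m /\
    forall k, vpa_lang A (u n ++ v k) <-> vpa_lang A (u m ++ v k).
Proof.
move=> uv.
pose reach w (q : vpa_state A) :=
  exists p s, vpa_initial p /\ vpa_run (A := A) w (p, [:: vpa_bot A]) (q, s).
(* Sets of states are encoded as boolean finite functions, so that they range over a finite type. *)
have [n [m [nm eq_reach]]] :=
  finite_range_collision (fun n => [ffun q => `[< reach (u n) q >]]).
have transfer i j k : (forall q, reach (u i) q -> reach (u j) q) ->
    vpa_lang A (u i ++ v k) -> vpa_lang A (u j ++ v k).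
  move=> ij [p [q [t [ip fq /vpa_run_cat[[r s] ru rv]]]]].
  have [|p' [s' [ip' ru']]] := ij r; first by exists p, s.
  (* The stacks [s] and [s'] left by [u i] and [u j] may differ: calls do not see the difference,
     and without calls both are the initial stack. *)
  suff [t' rv'] : exists t', vpa_run (A := A) (v k) (r, s') (q, t').
    exists p', q, t'; split=> //; apply/vpa_run_cat; by exists (r, s').
  case: uv => [cu|cv]; last exact: vpa_run_calls (cv k) rv.
  exists t; rewrite (vpa_run_not_calls (cu j) ru').
  by rewrite (vpa_run_not_calls (cu i) ru) in rv.
have reachE q : reach (u n) q <-> reach (u m) q.
  have /ffunP/(_ q) := eq_reach; rewrite !ffunE => e.
  by split=> /asboolP; [rewrite e|rewrite -e] => /asboolP.
exists n, m; split=> // k; split; apply: transfer => q; by apply reachE.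
Qed.

(** * Intersection with a regular language *)

Section ProductWithDFA.
Variables (Sigma T : finType) (delta : T -> Sigma -> T) (t0 : T) (F : pred T).
Variable A : vpa Sigma.

Let call (p : vpa_state A * T) a q g :=
  vpa_call p.1 a q.1 g && (q.2 == delta p.2 a).

Let call_not_bot p a q g : call p a q g -> g != vpa_bot A.
Proof. by move=> /andP[/vpa_call_not_bot]. Qed.

(** Only the states are enlarged; the stack alphabet and the partition are those of [A], so the
    product is still visibly pushdown. *)
Definition vpa_dfa_product : vpa Sigma :=
  @VPA Sigma (vpa_state A * T)%type (vpa_stack A) (vpa_bot A)
    (fun p => vpa_initial p.1 && (p.2 == t0))
    (fun p => vpa_final p.1 && F p.2)
    (vpa_kind A) call
    (fun p a q => vpa_internal p.1 a q.1 && (q.2 == delta p.2 a))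
    (fun p a g q => vpa_response p.1 a g q.1 && (q.2 == delta p.2 a))
    call_not_bot.

Lemma vpa_dfa_product_step a p t s q t' s' :
  vpa_step (A := vpa_dfa_product) a ((p, t), s) ((q, t'), s') <->
  vpa_step (A := A) a (p, s) (q, s') /\ t' = delta t a.
Proof.
split=> [st|[st ->]].
  inversion st as [? ? ? ? k tr|? ? ? k tr|? ? ? ? k gb tr|? ? ? k tr]; subst;
    move: tr => /= /andP[/= tr /eqP->]; split=> //; by constructor.
inversion st; subst.
- by apply: StepCall => //; apply/andP.
- by apply: StepInternal => //; apply/andP.
- by apply: StepPop => //; apply/andP.
- by apply: (@StepBottom _ vpa_dfa_product) => //; apply/andP.
Qed.

Lemma vpa_dfa_product_run w p t s q t' s' :
  vpa_run (A := vpa_dfa_product) w ((p, t), s) ((q, t'), s') <->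
  vpa_run (A := A) w (p, s) (q, s') /\ t' = foldl delta t w.
Proof.
elim: w p t t' s => [|a w IH] p t t' s /=; first by split=> [[-> -> ->]|[[-> ->] ->]].
split=> [[[[r t1] s1] /vpa_dfa_product_step[st ->] /IH[rw ->]]|[[[r s1] st rw] ->]].
  by split=> //; exists (r, s1).
by exists ((r, delta t a), s1); [apply/vpa_dfa_product_step|apply/IH].
Qed.

End ProductWithDFA.

Lemma VPL_setI_dfa (Sigma T : finType) (delta : T -> Sigma -> T) (t0 : T)
    (F : pred T) (L : set (seq Sigma)) :
  VPL L -> VPL (L `&` [set w | F (foldl delta t0 w)]).
Proof.
move=> [A ->]; exists (vpa_dfa_product delta t0 F A).
apply/seteqP; split=> w /=.
  move=> [[p [q [s [ip fq rw]]]] Fw].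
  exists (p, t0), (q, foldl delta t0 w), s; split=> /=; rewrite ?ip ?fq ?eqxx //.
  exact/vpa_dfa_product_run.
move=> [[p t] [[q t'] [s [/= /andP[ip /eqP->] /andP[fq Ft] /vpa_dfa_product_run]]]].
by move=> [rw e]; split; [exists p, q, s|rewrite -e].
Qed.

(** * Reduced words and the two inclusions *)

Section Reduced.
Variable X : finType.
Implicit Types (a b : letter X) (w : seq (letter X)).

(* [Some o] records the last letter read, if any; [None] is the sink reached
   after a factor [a a^-1]. *)
Let reduced_delta (t : option (option (letter X))) a :=
  match t with
  | None => None
  | Some None => Some (Some a)
  | Some (Some b) => if a == inv_letter b then None else Some (Some a)
  end.

Lemma reduced_dfa w : reduced w = isSome (foldl reduced_delta (Some None) w).
Proof.
have sink v : foldl reduced_delta None v = None by elim: v.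
have from b v : reduced (b :: v) = isSome (foldl reduced_delta (Some (Some b)) v).
  elim: v b => [|a v IH] b; first by rewrite reduced1.
  by rewrite reduced_cons /=; case: eqP => _; rewrite /= ?sink ?IH.
by case: w => [|a w]; [rewrite reduced_nil|exact: from].
Qed.

Lemma VPL_setI_reduced (L : set (seq (letter X))) :
  VPL L -> VPL (L `&` [set w | reduced w]).
Proof.
move=> /(VPL_setI_dfa reduced_delta (Some None) isSome).
by congr (VPL (_ `&` _)); apply/funext => w /=; rewrite reduced_dfa.
Qed.

(** The reduced words form a regular language, with which the full preimage is intersected. *)
Lemma VPL_forall_red (S : set (freegroup X)) : VPL_forall S -> VPL_red S.
Proof. by move=> /VPL_setI_reduced; rewrite setIC. Qed.

Lemma fgword_word_pi_id w : reduced w -> fgword (word_pi w) = w.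
Proof. by move=> rw; have /(congr1 (@fgword X)) := word_pi_id (FreeGroup rw). Qed.

Lemma VPL_red_exists (S : set (freegroup X)) : VPL_red S -> VPL_exists S.
Proof.
move=> LS; exists [set w | reduced w /\ S (word_pi w)] => //.
apply/seteqP; split=> [x [w [_ Sw] <-] //|x Sx].
exists (fgword x); last exact: word_pi_id.
by split; [exact: fgword_reduced|rewrite word_pi_id].
Qed.

Lemma positive_reduced w : all (fun a => ~~ a.2) w -> reduced w.
Proof.
elim: w => [|a w IH] /=; first by rewrite reduced_nil.
move=> /andP[pa pw]; rewrite reduced_cons IH // andbT.
case: w pw {IH} => //= b w /andP[pb _]; apply: contra pb => /eqP->.
by rewrite /= pa.
Qed.

Lemma word_pi_eq1_nseq a n m :
  word_pi (nseq n a ++ nseq m (inv_letter a)) = 1 <-> n = m.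
Proof.
have a_neq : a == inv_letter a = false.
  by apply/eqP => /(congr1 snd) /=; case: a.2.
have red k : foldr (@cons_reduce X) [::] (nseq k (inv_letter a)) =
    nseq k (inv_letter a).
  by elim: k => //= k ->; case: k => //= k; rewrite inv_letterK eq_sym a_neq.
(* Subtraction is truncated, so at most one of the two exponents is nonzero. *)
have cancel k : foldr (@cons_reduce X) (nseq m (inv_letter a)) (nseq k a) =
    nseq (m - k) (inv_letter a) ++ nseq (k - m) a.
  elim: k => [|k IH] /=; first by rewrite subn0 cats0.
  rewrite IH; case: (leqP m k) => mk.
    have -> : m - k.+1 = 0 by apply/eqP/leqW.
    rewrite (eqP mk) subSn //=.
    by case: (k - m) => //= j; rewrite a_neq.
  by rewrite -(subnSK mk) /= eqxx (eqP (ltnW mk)) (eqP mk : k.+1 - m = 0).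
have fg : fgword (word_pi (nseq n a ++ nseq m (inv_letter a))) =
    nseq (m - n) (inv_letter a) ++ nseq (n - m) a.
  by rewrite fgword_word_pi foldr_cat red cancel.
split=> [e|enm]; last first.
  by apply: val_inj => /=; rewrite fg enm subnn.
move: fg; rewrite e => /(congr1 size); rewrite size_cat !size_nseq /=.
by move=> /esym/eqP; rewrite addn_eq0 !subn_eq0 andbC -eqn_leq => /eqP.
Qed.

End Reduced.

(** * The trivial subgroup in rank one *)

Lemma VPL_nil (Sigma : finType) : VPL [set [::] : seq Sigma].
Proof.
exists (@VPA Sigma unit unit tt predT predT (fun=> Internal)
  (fun _ _ _ _ => false) (fun _ _ _ => false) (fun _ _ _ _ => false)
  (fun _ _ _ _ => ltac:(done))).
apply/seteqP; split=> [_ ->|[//|a w]]; first by exists tt, tt, [:: tt].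
by move=> [p [q [s [_ _ [e]]]]] []; inversion 1.
Qed.

Section TrivialSubgroup.

Let a : letter unit := (tt, false).

Lemma VPL_red_one : VPL_red [set 1 : freegroup unit].
Proof.
rewrite /VPL_red.
suff -> : [set w : seq (letter unit) | reduced w /\ [set 1] (word_pi w)] = [set [::]].
  exact: VPL_nil.
apply/seteqP; split=> [w [rw /= w1]|_ ->].
  by rewrite /= -(fgword_word_pi_id rw) w1.
by split; [exact: reduced_nil|rewrite /= /word_pi big_nil].
Qed.

Lemma not_VPL_forall_one : ~ VPL_forall [set 1 : freegroup unit].
Proof.
move=> [A LA].
(* The suffix with [k = n] tells the two prefixes apart: it cancels [b^n] but not [b^m]. *)
have no_collision (b : letter unit) n m : n < m ->
    ~ (forall k, vpa_lang A (nseq n b ++ nseq k (inv_letter b)) <->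
                 vpa_lang A (nseq m b ++ nseq k (inv_letter b))).
  move=> nm /(_ n) [+ _]; rewrite -LA /= => /(_ _)/word_pi_eq1_nseq mn.
  by move: nm; rewrite mn ?ltnn //; exact/word_pi_eq1_nseq.
have all_nseq_kind (P : pred (letter unit)) b n : P b -> all P (nseq n b).
  by move=> Pb; rewrite all_nseq Pb orbT.
(* If [a] is a call, it serves as suffix, in the words [a^-n a^k]; otherwise it serves as prefix, in
   [a^n a^-k]. *)
case: (boolP (is_call (vpa_kind A a))) => ka.
  have [|n [m [nm]]] := @vpa_collision _ A (nseq^~ (inv_letter a)) (nseq^~ a).
    by right=> n; apply: all_nseq_kind.
  by rewrite -[in X in X -> _](inv_letterK a); exact: no_collision.
have [|n [m [nm]]] := @vpa_collision _ A (nseq^~ a) (nseq^~ (inv_letter a)).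
  by left=> n; apply: all_nseq_kind.
exact: no_collision.
Qed.

End TrivialSubgroup.

(** * The elements [a^n b a^m] with [m < n] *)

Section UnbalancedPowers.

Let a : letter bool := (false, false).
Let b : letter bool := (true, false).
Let bV : letter bool := (true, true).

Let word n m := nseq n a ++ b :: nseq m a.

Definition unbalanced_powers : set (freegroup bool) :=
  [set x | exists n m, m < n /\ fgword x = word n m].

Let word_inj n m n' m' : word n m = word n' m' -> n = n' /\ m = m'.
Proof.
have idx i j : index b (word i j) = i.
  by rewrite /word index_cat mem_nseq andbF size_nseq /= addn0.
move=> e; have en := congr1 (index b) e; rewrite !idx in en.
move: e; rewrite en => /(congr1 size).
by rewrite !size_cat /= !size_nseq => /addnI[->].
Qed.

Let word_reduced n m : reduced (word n m).
Proof. by apply: positive_reduced; rewrite all_cat /= !all_nseq !orbT. Qed.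

Lemma not_VPL_red_unbalanced_powers : ~ VPL_red unbalanced_powers.
Proof.
move=> [A LA].
have langE n m : vpa_lang A (word n m) <-> m < n.
  rewrite -LA /= /unbalanced_powers /= fgword_word_pi_id //.
  split=> [[_ [i [j [ji /word_inj[-> ->]]]]] //|mn].
  by split=> //; exists n, m.
(* The test is again [k = n]: [word m n] is accepted, [word n n] is not. *)
have no_collision n m : n < m ->
    ~ (forall k, vpa_lang A (word n k) <-> vpa_lang A (word m k)).
  by move=> nm /(_ n) [_ H]; have := H ((langE m n).2 nm) => /langE; rewrite ltnn.
(* The letter [b] joins the factor on which [vpa_collision] puts no condition, so its kind does not
   matter. *)
case: (boolP (is_call (vpa_kind A a))) => ka.
  have [|n [m [nm H]]] :=
      @vpa_collision _ A (fun n => rcons (nseq n a) b) (nseq^~ a).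
    by right=> n; rewrite all_nseq ka orbT.
  by apply: (no_collision n m nm) => k; have := H k; rewrite !cat_rcons.
have [|n [m [nm]]] := @vpa_collision _ A (nseq^~ a) (fun n => b :: nseq n a).
  by left=> n; rewrite all_nseq ka orbT.
exact: no_collision.
Qed.

(** [s0] reads the leading [a^n], [s1] accepts between blocks [a b b^-1], and [s2], [s3] lie inside
    a block, after [a] and after [a b]. *)
Let s0 := (false, false).
Let s1 := (true, false).
Let s2 := (true, true).
Let s3 := (false, true).

(* Accepts [a^n b (a b b^-1)^m] with [m < n], not [m <= n]: the letter [b] that
   leaves [s0] already pops one symbol. *)
Let unbalanced_vpa : vpa (letter bool) :=
  @VPA (letter bool) (bool * bool)%type bool false
    (pred1 s0) (pred1 s1) (fun c => if c.1 then Response else Call)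
    (fun p c q g => [&& (p, c, q) \in [:: (s0, a, s0); (s1, a, s2)] & g != false])
    (fun _ _ _ => false)
    (fun p c g q =>
       [&& (p, c, q) \in [:: (s0, b, s1); (s2, b, s3); (s3, bV, s1)] & g])
    (fun _ _ _ _ tr => proj2 (andP tr)).

(** The stack is a unary counter above the bottom symbol [false]; responses need [true] on top, so a
    run blocks at zero. *)
Let stack k : seq bool := nseq k true ++ [:: false].

Let step_call p q k :
  (p, q) \in [:: (s0, s0); (s1, s2)] ->
  vpa_step (A := unbalanced_vpa) a (p, stack k) (q, stack k.+1).
Proof.
by rewrite !inE => /orP[]/eqP[-> ->]; apply: StepCall.
Qed.

Let step_response p c q k :
  (p, c, q) \in [:: (s0, b, s1); (s2, b, s3); (s3, bV, s1)] ->
  vpa_step (A := unbalanced_vpa) c (p, stack k.+1) (q, stack k).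
Proof.
by rewrite !inE => /or3P[]/eqP[-> -> ->]; apply: StepPop.
Qed.

Let step_inv p c q k s :
  vpa_step (A := unbalanced_vpa) c (p, stack k) (q, s) ->
  (s = stack k.+1 /\ (p, c, q) \in [:: (s0, a, s0); (s1, a, s2)]) \/
  (exists2 k', k = k'.+1 /\ s = stack k' &
     (p, c, q) \in [:: (s0, b, s1); (s2, b, s3); (s3, bV, s1)]).
Proof.
(* Naming the stack keeps its shape as an equation through the inversion. *)
have [t et] : exists t, t = stack k by exists (stack k).
rewrite -et => st; move: et.
inversion st as [p' q' g s' kc tr|? ? ? kc tr|p' q' g s' kc gb tr|? ? ? kc tr]; subst => et.
- by left; move: tr => /andP[? gt]; rewrite et; case: g gt {st}.
- by [].
- right; case: k et => [|k] [eg es]; first by rewrite eg in gb.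
  by exists k => //; case/andP: tr.
- by case/andP: tr.
Qed.

(** The reductions [v] of the words that lead from state [p] with counter [k] to [s1]. A complete
    block lowers the counter by one; in [s2] two pops of the current block are still due, in [s3]
    one. *)
Let suffix_value p k v :=
  match p with
  | (false, false) => exists n m, m < n + k /\ v = word n m
  | (true, false) => exists2 m, m <= k & v = nseq m a
  | (true, true) => exists2 m, m.+1 < k & v = nseq m a
  | (false, true) => exists2 m, m < k & v = bV :: nseq m a
  end.

(** Letters are prepended one at a time to a reduced suffix; the only cancellation is that of [b]
    read in [s2] against [b^-1]. *)
Let run_value w p k s :
  vpa_run (A := unbalanced_vpa) w (p, stack k) (s1, s) ->
  suffix_value p k (foldr (@cons_reduce bool) [::] w).
Proof.
elim: w p k => [|c w IH] p k /=; first by case=> -> _; exists 0.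
case=> -[q s'] /step_inv[[-> tr]|[k' [-> ->] tr]] /IH; move: tr; rewrite !inE.
  case/orP=> /eqP[-> -> ->] /= [].
    move=> n [m [mn ->]]; exists n.+1, m; rewrite addSnnS; split=> //.
    by case: n {mn}.
  by move=> m mk ->; exists m.+1 => //; case: m {mk}.
case/or3P=> /eqP[-> -> ->] /= [m mk ->].
- by exists 0, m; split=> //; case: m {mk}.
- by exists m.
- by exists m => //; case: m {mk}.
Qed.

(** Converse of [run_value] at [s1]: [m] blocks are read, each using up one unit of the counter. *)
Let run_blocks m k : m <= k -> exists w s,
  vpa_run (A := unbalanced_vpa) w (s1, stack k) (s1, s) /\
  foldr (@cons_reduce bool) [::] w = nseq m a.
Proof.
elim: m k => [|m IH] k mk; first by exists [::], (stack k).
case: k mk => // k mk; have [w [s [rw fw]]] := IH k mk.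
exists [:: a, b, bV & w], s; split; last first.
  by rewrite /= fw; case: (m) => [|j] /=.
exists (s2, stack k.+2); first exact: step_call.
exists (s3, stack k.+1); first exact: step_response.
by exists (s1, stack k); first exact: step_response.
Qed.

Let run_word n m k : m < n + k -> exists w s,
  vpa_run (A := unbalanced_vpa) w (s0, stack k) (s1, s) /\
  foldr (@cons_reduce bool) [::] w = word n m.
Proof.
elim: n k => [|n IH] k mk.
  rewrite add0n in mk; case: k mk => // k mk; have [w [s [rw fw]]] := @run_blocks m k mk.
  exists (b :: w), s; split; last by rewrite /= fw; case: (m).
  by exists (s1, stack k); first exact: step_response.
have [|w [s [rw fw]]] := IH k.+1; first by rewrite addnS.
exists (a :: w), s; split; last by rewrite /= fw; case: (n).
by exists (s0, stack k.+1); first exact: step_call.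
Qed.

Lemma VPL_exists_unbalanced_powers : VPL_exists unbalanced_powers.
Proof.
exists (vpa_lang unbalanced_vpa); first by exists unbalanced_vpa.
apply/seteqP; split=> [_ [w [p [q [s [/eqP-> /eqP-> rw]]]] <-]|x [n [m [mn xE]]]].
  have [n [m [mn fw]]] := @run_value w s0 0 s rw.
  by exists n, m; rewrite fgword_word_pi fw -[n]addn0.
have [|w [s [rw fw]]] := @run_word n m 0; first by rewrite addn0.
exists w; first by exists s0, s1, s.
by apply: val_inj; rewrite /= fgword_word_pi fw xE.
Qed.

End UnbalancedPowers.

Theorem proposition7 :
  [/\ forall (X : finType) (S : set (freegroup X)), VPL_forall S -> VPL_red S,
      forall (X : finType) (S : set (freegroup X)), VPL_red S -> VPL_exists S,
      exists (X : finType) (S : set (freegroup X)), VPL_red S /\ ~ VPL_forall S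
    & exists (X : finType) (S : set (freegroup X)), VPL_exists S /\ ~ VPL_red S].
Proof.
split=> [X S|X S||].
- exact: VPL_forall_red.
- exact: VPL_red_exists.
- by exists unit, [set 1]; split; [exact: VPL_red_one|exact: not_VPL_forall_one].
- exists bool, unbalanced_powers; split.
    exact: VPL_exists_unbalanced_powers.
  exact: not_VPL_red_unbalanced_powers.
Qed.
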